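(* Let $q>c\ge 1$ be integers. Then $$v_0(q+1,c+1)\ \ge\ \frac{1}{c}\left(q^2+q+\frac{2(q-c+1)}{c+1}\right)+1.$$
   Context: For integers $k\ge t$, a $(v,k,t)$ packing of size $b$ is a system of $b$ subsets (blocks) of a $v$-element underlying set such that each block has exactly $k$ elements and every $t$-element set is contained in at most one block. $P(v,k,t)$ denotes the maximum possible size $b$ of a $(v,k,t)$ packing. $v_0(k,t)$ denotes the minimum $v$ such that $P(v,k,t)>v$. *)

(* Defs.v *)
From mathcomp Require Import all_boot all_order all_algebra.

Set Implicit Arguments.
Unset Strict Implicit.
Unset Printing Implicit Defensive.

(* The blocks form a set rather than a multiset: for t <= k a repeated block
   would put some t-element set in two blocks, so nothing is lost. *)
Definition is_packing (T : finType) (k t : nat) (B : {set {set T}}) : bool :=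
  [forall b in B, #|b| == k]
  && [forall A : {set T}, (#|A| == t) ==> (#|[set b in B | A \subset b]| <= 1)].

Definition packing_number (v k t : nat) : nat :=
  \max_(B : {set {set 'I_v}} | is_packing k t B) #|B|.

Lemma packing_number_ge (T : finType) (k t : nat) (B : {set {set T}}) :
  is_packing k t B -> #|B| <= packing_number #|T| k t.
Proof.
case/andP=> /'forall_implyP Bk /'forall_implyP Bt.
have imI := imset_inj (@enum_rank_inj T).
set C := [set enum_rank @: b | b : {set T} in B].
rewrite -(card_imset _ imI) -/C.
apply: (@leq_bigmax_cond _ _ (fun X : {set {set 'I_#|T|}} => #|X|)).
apply/andP; split.
  apply/'forall_implyP=> _ /imsetP[b Bb ->].
  by rewrite (card_imset _ (@enum_rank_inj T)) Bk.
apply/'forall_implyP=> A At.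
have /Bt : #|enum_val @: A| == t by rewrite (card_imset _ (@enum_val_inj _ _)).
apply: leq_trans; rewrite -(card_imset _ imI) subset_leq_card //.
apply/subsetP=> _ /setIdP[/imsetP[b Bb ->] Ab].
apply/imset_f; rewrite inE Bb; apply/subsetP=> _ /imsetP[i iA ->].
by have /imsetP[x xb ->] := subsetP Ab _ iA; rewrite enum_rankK.
Qed.

(* Existence for 2 <= t <= k: on 'I_k * 'F_p with p > k prime, the p ^ 2 graphs
   of the affine maps i |-> a * i + c pairwise meet in at most one point. *)
Lemma packing_number_gt (k t : nat) :
  1 < t <= k -> exists v, v < packing_number v k t.
Proof.
case/andP=> t1 tk; have [p kp pp] := prime_above k.
pose line (ac : 'F_p * 'F_p) : {set 'I_k * 'F_p} :=
  [set (i, (ac.1 * (i : nat)%:R + ac.2)%R) | i : 'I_k].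
have natI (i j : 'I_k) : (i%:R : 'F_p)%R = (j%:R)%R -> i = j.
  move/(congr1 (@nat_of_ord _)); rewrite !val_Fp_nat //.
  by rewrite !modn_small ?(ltn_trans _ kp) //; apply: val_inj.
have lineE u x : x \in line u -> x.2 = (u.1 * (x.1 : nat)%:R + u.2)%R.
  by case/imsetP=> i _ ->.
have line2 (A : {set 'I_k * 'F_p}) u w :
  1 < #|A| -> A \subset line u -> A \subset line w -> u = w.
  case/card_gt1P=> x [y [xA yA xy]] /subsetP Au /subsetP Aw.
  have xu := lineE _ _ (Au _ xA); have yu := lineE _ _ (Au _ yA).
  have xw := lineE _ _ (Aw _ xA); have yw := lineE _ _ (Aw _ yA).
  have ij : x.1 != y.1.
    apply: contraNneq xy => ij; apply/eqP.
    rewrite (surjective_pairing x) (surjective_pairing y).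
    by rewrite xu yu ij.
  have d : ((u.1 - w.1) * ((x.1 : nat)%:R - (y.1 : nat)%:R) = 0)%R.
    have : (x.2 - y.2 = x.2 - y.2)%R by [].
    rewrite {1}xu {1}yu xw yw.
    rewrite !GRing.opprD !(GRing.addrACA _ _ (- (_ * _)))%R !GRing.subrr !GRing.addr0.
    rewrite -!GRing.mulrBr => e.
    by rewrite GRing.mulrBl e GRing.subrr.
  move/eqP: d; rewrite GRing.mulf_eq0 !GRing.subr_eq0.
  case/orP=> [/eqP e1 | /eqP/natI e]; last by rewrite e eqxx in ij.
  move: xw; rewrite xu e1 => /GRing.addrI e2.
  by rewrite (surjective_pairing u) (surjective_pairing w) e1 e2.
have lineK u : #|line u| = k.
  by rewrite card_imset ?card_ord // => i j [].
have line_inj : injective line.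
  by move=> u w e; apply: (@line2 (line u)); rewrite ?lineK -?e // (leq_trans t1).
exists #|{: 'I_k * 'F_p}|.
apply: leq_trans (packing_number_ge (B := [set line u | u : 'F_p * 'F_p]) _).
  rewrite card_imset // !card_prod card_ord card_Fp // ltn_pmul2r //.
  exact: prime_gt0.
apply/andP; split; first by apply/'forall_implyP=> _ /imsetP[u _ ->]; rewrite lineK.
apply/'forall_implyP=> A /eqP At; rewrite leqNgt; apply/card_gt1P.
case=> _ [_ [/setIdP[/imsetP[u _ ->] Au] /setIdP[/imsetP[w _ ->] Aw]]].
by rewrite (line2 A u w) ?eqxx ?At.
Qed.

(* The value 0 outside 2 <= t <= k is a placeholder: if t < 2 and 1 <= k, then
   packing_number v k t <= v for every v. *)
Definition v0 (k t : nat) : nat :=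
  if decP (@idP (1 < t <= k)) is left tk then ex_minn (packing_number_gt tk)
  else 0.

Lemma v0P (k t : nat) : 1 < t <= k ->
  v0 k t < packing_number (v0 k t) k t
  /\ forall v, v < packing_number v k t -> v0 k t <= v.
Proof. by rewrite /v0; case: decP => // tk _; case: ex_minnP. Qed.

(* Main.v *)
Require Import Defs.
From mathcomp Require Import all_boot all_order all_algebra.
From mathcomp Require Import zify lra.

Import Order.TTheory GRing.Theory Num.Theory.
Local Open Scope ring_scope.

(** If a packing has more blocks than points, then by averaging some point [x]
    lies on at least [q + 2] blocks.  Deleting [x] from [q + 2] of them leaves
    [q]-sets on [v - 1] points that pairwise meet in at most [c - 1] points.
    Double counting bounds the first two moments of their degrees [d], and the
    result follows by summing [(d - c) (d - (c + 1)) >= 0], which holds because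
    degrees are integers. *)

Section DoubleCounting.
Local Open Scope nat_scope.
Variable T : finType.
Implicit Types (D : {set T}) (F : {set {set T}}).

Let degree F x := #|[set b in F | x \in b]|.

Lemma sum_degree D F : \sum_(x in D) degree F x = \sum_(b in F) #|b :&: D|.
Proof.
transitivity (\sum_(x in D) \sum_(b in F) (x \in b : nat)).
  apply: eq_bigr => x _; rewrite /degree -sum1_card big_mkcond /= [RHS]big_mkcond.
  by apply: eq_bigr => b _; rewrite inE; case: (b \in F); case: (x \in b).
rewrite exchange_big; apply: eq_bigr => b _.
rewrite -sum1_card big_mkcond [RHS]big_mkcond /=.
by apply: eq_bigr => x _; rewrite inE; case: (x \in D); case: (x \in b).
Qed.

(** Only one factor of the square is expanded; after exchanging sums, each [b] leaves the degree sum
    over [b :&: D], to which [sum_degree] applies. *)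
Lemma sum_degree_sqr D F :
  \sum_(x in D) degree F x ^ 2 = \sum_(b in F) \sum_(b' in F) #|b' :&: (b :&: D)|.
Proof.
transitivity (\sum_(x in D) \sum_(b in F) (x \in b) * degree F x).
  apply: eq_bigr => x _; rewrite -big_distrl -mulnn; congr (_ * _).
  rewrite {1}/degree -sum1_card big_mkcond [RHS]big_mkcond /=.
  by apply: eq_bigr => b _; rewrite inE; case: (b \in F); case: (x \in b).
rewrite exchange_big; apply: eq_bigr => b _; rewrite -sum_degree.
rewrite big_mkcond [RHS]big_mkcond /=; apply: eq_bigr => x _.
by rewrite inE; case: (x \in D); case: (x \in b); rewrite ?mul1n.
Qed.

Lemma card_points_ge n k l D F :
    {in F, forall b, #|b :&: D| = k} ->
    {in F &, forall b b', b != b' -> #|b' :&: (b :&: D)| <= l} ->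
  n.*2.+1 * (#|F| * k) <= #|F| * (k + #|F|.-1 * l) + #|D| * (n * n.+1).
Proof.
move=> Fk Fl.
have <- : \sum_(x in D) degree F x = #|F| * k.
  by rewrite sum_degree (eq_bigr _ Fk) sum_nat_const.
have le2 : \sum_(x in D) degree F x ^ 2 <= #|F| * (k + #|F|.-1 * l).
  rewrite sum_degree_sqr -sum_nat_const; apply: leq_sum => b Fb.
  (* The diagonal pair contributes [k], each of the other [#|F|.-1] pairs at most [l]. *)
  rewrite (bigD1 b) //= setIA setIid Fk // leq_add2l.
  rewrite (cardsD1 b) Fb /= -sum_nat_const.
  rewrite [leqRHS](eq_bigl (fun b' => (b' \in F) && (b' != b))); last first.
    by move=> b'; rewrite !inE andbC.
  by apply: leq_sum => b' /andP[Fb' nb]; rewrite Fl // eq_sym.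
apply: leq_trans (leq_add le2 (leqnn _)).
rewrite -sum_nat_const -big_split big_distrr; apply: leq_sum => x _ /=.
(* No integer lies strictly between [n] and [n.+1], so the factors [d - n] and [d - (n + 1)] never
   have opposite signs. *)
have [|] := leqP (degree F x) n; nia.
Qed.

End DoubleCounting.

(** Any [t.+1] common points would form a set lying in two blocks. *)
Lemma packing_meet {T : finType} {k t : nat} {B : {set {set T}}} :
  is_packing k t.+1 B ->
  {in B &, forall b b', b != b' -> (#|b' :&: b| <= t)%N}.
Proof.
case/andP=> _ /'forall_implyP Bt b b' Bb Bb' neq_bb'; rewrite leqNgt.
apply/negP => /card_geqP [s [us st ss]].
have /Bt/card_le1_eqP e : #|[set:: s]| == t.+1 by rewrite cardsE (card_uniqP us) st.
case/eqP: neq_bb'; apply: e; rewrite inE ?Bb ?Bb'; apply/subsetP => y;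
  by rewrite inE => /ss; rewrite inE => /andP[].
Qed.

Lemma packing_card_gt {T : finType} {q c : nat} {B : {set {set T}}} :
    (0 < c)%N -> is_packing q.+1 c.+1 B -> (#|T| < #|B|)%N ->
  (c.*2.+1 * (q.+2 * q) <= q.+2 * (q + q.+1 * c.-1) + #|T|.-1 * (c * c.+1))%N.
Proof.
move=> c0 packB ltTB; have /andP[/'forall_implyP Bk _] := packB.
have [x degx] : exists x, (q.+1 < #|[set b in B | x \in b]|)%N.
  (* If every point were on at most [q.+1] blocks, counting incidences would give
     [#|B| * q.+1 <= #|T| * q.+1]. *)
  apply/existsP; apply: contraLR ltTB; rewrite negb_exists -leqNgt => /forallP le.
  rewrite -(leq_pmul2r (ltn0Sn q)) -sum_nat_const.
  rewrite (eq_bigr (fun b => #|b :&: [set: T]|)); last first.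
    by move=> b Bb; rewrite setIT (eqP (Bk b Bb)).
  rewrite -sum_degree -cardsT -sum_nat_const.
  by apply: leq_sum => x _; rewrite leqNgt.
have /card_geqP [s [us sq sB]] := degx.
have {sB}FB b : b \in [set:: s] -> b \in B /\ x \in b.
  by rewrite inE => /sB; rewrite inE => /andP.
have cardF : #|[set:: s]| = q.+2 by rewrite cardsE (card_uniqP us).
have DE b : b :&: [set~ x] = b :\ x by rewrite setDE.
(* Intersecting with [[set~ x]] plays the role of deleting [x]. The choice [n = c] fits because, at
   the claimed bound, the average degree [q * (q + 2) / (v - 1)] lies between [c] and [c + 1]. *)
have := @card_points_ge T c q c.-1 [set~ x] [set:: s].
rewrite cardF cardsC1; apply.
  move=> b /FB[Bb xb]; rewrite DE.
  by have /eqP := Bk b Bb; rewrite (cardsD1 x) xb => -[].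
move=> b b' /FB[Bb xb] /FB[Bb' xb'] nbb'; rewrite setIA DE.
have := packing_meet packB b b' Bb Bb' nbb'.
by rewrite (cardsD1 x) inE xb xb'; case: c c0 {packB}.
Qed.

Theorem claim3 (q c : nat) (hc : (1 <= c)%N) (hcq : (c < q)%N) :
  (v0 q.+1 c.+1)%:R >=
    1 / c%:R * (q%:R ^+ 2 + q%:R + 2 * (q%:R - c%:R + 1) / (c%:R + 1)) + 1 :> rat.
Proof.
have tk : (1 < c.+1 <= q.+1)%N by rewrite !ltnS hc ltnW.
have [+ _] := v0P tk; set v := v0 _ _.
rewrite /packing_number => ltv.
have [B packB ltB] : exists2 B : {set {set 'I_v}},
    is_packing q.+1 c.+1 B & (#|'I_v| < #|B|)%N.
  apply/exists_inP; apply: contraLR ltv.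
  rewrite negb_exists_in -leqNgt => /'forall_implyP le.
  by apply/bigmax_leqP => B /le; rewrite -leqNgt card_ord.
have := packing_card_gt hc packB ltB; rewrite card_ord.
case: c hc hcq {tk ltv B packB ltB} @v => // c _ ltcq v.
(* Since [0.-1 = 0], the case [v = 0] has to be refuted from the inequality itself. *)
case: v => [|v] /= le; first by nia.
(* The common term [q.+2 * q] cancels. From here [c] and [v] stand for the original values minus
   one. *)
have {le} : (q.+2 * (c.+1.*2 * q)%N <= q.+2 * (q.+1 * c) + v * (c.+1 * c.+2))%N by nia.
rewrite -(ler_nat rat) -mul2n !(natrD, natrM, =^~ natr1).
set x : rat := q%:R; set y : rat := c%:R; set z : rat := v%:R => le.
have y0 : 0 <= y by exact: ler0n.
rewrite lerD2r mulrC mulrA mulr1 ler_pdivrMr ?ltr_wpDl //.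
rewrite -lerBrDl ler_pdivrMr; first by lra.
by lra.
Qed.
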